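(* Let $D$ be the center of an $A_6^8(1)$-polytope in $4_{21}$. Then $2D+7K_{S_8}$ is a skew $7$-line, $2D+7K_{S_8}=\sum_{i=1}^7 l_{a_i}$ with $l_{a_1},\dots,l_{a_7}\in L_8$ pairwise disjoint. Furthermore, each $A_6^8(1)$-polytope in $4_{21}$ with center $D$ contains exactly seven cornered $A_3^8(1)$-polytopes (as four-element subsets), and these are contained in the vertex figures of $l_{a_1},\dots,l_{a_7}$ respectively.
   Context: $S_8$ is a del Pezzo surface obtained by blowing up $\mathbb{P}^2$ at $8$ points (with $-K_{S_8}$ ample). $\mathrm{Pic}\,S_8=\mathbb{Z}h\oplus\mathbb{Z}e_1\oplus\dots\oplus\mathbb{Z}e_8$ with intersection form $h^2=1$, $h\cdot e_i=0$, $e_i\cdot e_j=-\delta_{ij}$, and $K_{S_8}=-3h+\sum_{i=1}^8 e_i$. A line is a class $l\in\mathrm{Pic}\,S_8$ with $l^2=l\cdot K_{S_8}=-1$; $L_8$ is the set of lines, which is the vertex set of the Gosset polytope $4_{21}$ (the convex hull of $L_8$). A skew $a$-line is a class $l_1+\dots+l_a$ with $l_1,\dots,l_a\in L_8$ distinct and pairwise disjoint ($l_i\cdot l_j=0$ for $i\ne j$); the set $\{l_1,\dots,l_a\}$ is uniquely determined by the class. An $A_n^8(1)$-polytope in $4_{21}$ is a set of $n+1$ distinct lines in $L_8$ with pairwise intersection number $1$; its center is the sum of these lines. The vertex figure of $l\in L_8$ is $\{l'\in L_8: l'\cdot l=0\}$. An $A_n^8(1)$-polytope is cornered if there is a line $l\in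 L_8$ whose vertex figure contains all its lines. *)

(* Defs.v *)
From mathcomp Require Import all_boot all_order all_algebra.
From mathcomp Require Import finmap.

Set Implicit Arguments.
Unset Strict Implicit.
Unset Printing Implicit Defensive.

Import GRing.Theory.
Local Open Scope ring_scope.

(* A class is its row of coordinates in the basis (h, e_1, ..., e_8):
   column 0 is the coefficient of h, column i + 1 that of e_(i + 1) (the
   exceptional classes are numbered from 0 below). *)
Notation Pic := 'rV[int]_9.

Definition h : Pic := delta_mx 0 ord0.
Definition e (i : 'I_8) : Pic := delta_mx 0 (lift ord0 i).

Definition dot (C D : Pic) : int :=
  C 0 ord0 * D 0 ord0
  - \sum_(i < 8) C 0 (lift ord0 i) * D 0 (lift ord0 i).

Definition K : Pic := - (h *+ 3) + \sum_(i < 8) e i.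

Lemma dot_hh : dot h h = 1.
Proof.
by rewrite /dot !mxE /= big1 ?subr0 // => i _; rewrite !mxE /= mul0r.
Qed.

Lemma dot_he (i : 'I_8) : dot h (e i) = 0.
Proof.
by rewrite /dot !mxE /= mulr0 big1 ?subr0 // => j _; rewrite !mxE /= mul0r.
Qed.

Lemma dot_ee (i j : 'I_8) : dot (e i) (e j) = - (i == j)%:R.
Proof.
rewrite /dot !mxE /= mul0r add0r (bigD1 i) //= big1 => [|k ki].
  by rewrite !mxE !(inj_eq lift_inj) !eqxx mul1r addr0.
by rewrite !mxE !(inj_eq lift_inj) (negbTE ki) mul0r.
Qed.

Definition L8 : {pred Pic} := [pred l : Pic | (dot l l == -1) && (dot l K == -1)].

Definition vertex_figure (l : Pic) : {pred Pic} :=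
  [pred l' : Pic | (l' \in L8) && (dot l' l == 0)].

Definition skew_family (a : nat) (l : 'I_a -> Pic) : Prop :=
  [/\ injective l,
      forall i, l i \in L8
    & forall i j, i != j -> dot (l i) (l j) = 0].

Definition skew_line (a : nat) (C : Pic) : Prop :=
  exists2 l : 'I_a -> Pic, skew_family l & C = \sum_(i < a) l i.

(* The A_n^8(1)-polytopes in 4_21, given by their vertices. *)
Definition A81_polytope (n : nat) (P : {fset Pic}) : Prop :=
  [/\ #|` P| = n.+1,
      {subset P <= L8}
    & {in P &, forall l l' : Pic, l != l' -> dot l l' = 1}].

Definition center (P : {fset Pic}) : Pic := \sum_(l <- P) l.

Definition cornered (P : {fset Pic}) : Prop :=
  exists2 l : Pic, l \in L8 & {subset P <= vertex_figure l}.

(* Main.v *)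
From HB Require Import structures.
Require Import Defs.
From mathcomp Require Import all_boot all_order all_algebra.
From mathcomp Require Import finmap zify ring.
From mathcomp Require mxabelem.
Import Order.TTheory GRing.Theory Num.Theory.

(** For a line [l], the class [l + K] is orthogonal to [K] and has square -2: it
    is a root of the lattice [K^perp], which is E8 with the opposite sign.  Two
    lines meet once exactly when their roots are orthogonal, so the vertices of
    an A_6(1)-polytope are seven pairwise orthogonal roots a_1, ..., a_7, and
    everything is governed by the binary code

      C = { S : the sum of the a_i, i in S, is divisible by 2 in Pic }.

    The intersection form is nondegenerate modulo 2 and the a_i span a totally
    isotropic subspace of F_2^9, which has dimension at most 4; hence C has
    dimension at least 3 ([card_code_isotropic]).  If S is a nonzero word, half
    of its sum is a class b_S of square - #|S| / 2, and the form is even on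
    [K^perp]; so every nonzero word has weight 4 ([code_weight]).  Counting
    incidences between words and coordinates, a code of length 7 with these two
    properties has exactly 8 words, and each coordinate lies in exactly 4 of
    them ([card_four_weight_code]): C is the [7,3] simplex code, whose nonzero
    words are the complements of the lines of the Fano plane.

    Two distinct nonzero words share 2 coordinates, which makes the seven classes
    b_S - K pairwise disjoint lines; as each coordinate is covered 4 times, they
    add up to 2 D + 7 K ([sum_corner_line]).  The line b_S - K is disjoint from
    the vertices in S and meets the three others once, so S is cornered by it.
    Conversely, if four vertices are cornered by a line [c], then 2 (c + K) minus
    the sum of their roots is orthogonal to [K] and has square zero.  Since the
    form is negative definite on [K^perp], this difference vanishes and the four
    vertices form a word of C ([cornered_code]), with c = b_S - K.

    Finally, distinct lines never meet negatively ([line_dot_ge0]), so a sum of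
    pairwise disjoint lines determines its summands ([skew_sum_mem]).  Hence any
    decomposition of 2 D + 7 K, for any polytope of center D, consists of the
    lines b_S - K. *)

Set Implicit Arguments.
Unset Strict Implicit.
Unset Printing Implicit Defensive.

Local Open Scope fset_scope.
Local Open Scope ring_scope.

(** * The intersection form *)

Lemma dotC x y : dot x y = dot y x.
Proof.
by rewrite /dot mulrC; congr (_ - _); apply: eq_bigr => i _; rewrite mulrC.
Qed.

Fact dot_is_zmod_morphism x : zmod_morphism (dot x).
Proof.
move=> y z; rewrite /dot !mxE mulrBr.
under eq_bigr do rewrite !mxE mulrBr.
by rewrite sumrB; ring.
Qed.

HB.instance Definition _ x :=
  GRing.isZmodMorphism.Build Pic int (dot x) (dot_is_zmod_morphism x).

Lemma dot_suml (I : finType) (P : pred I) (F : I -> Pic) y :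
  dot (\sum_(i | P i) F i) y = \sum_(i | P i) dot (F i) y.
Proof. by rewrite dotC raddf_sum; apply: eq_bigr => i _; rewrite dotC. Qed.

Lemma dotDl x y z : dot (x + y) z = dot x z + dot y z.
Proof. by rewrite dotC raddfD /= !(dotC z). Qed.

(** Expanding both arguments in one step keeps rewriting from also expanding [K],
    which unfolds to a sum. *)
Lemma dotDD x y z t :
  dot (x + y) (z + t) = dot x z + dot x t + dot y z + dot y t.
Proof. by rewrite dotDl !raddfD /= !addrA. Qed.

Lemma dotNl x z : dot (- x) z = - dot x z.
Proof. by rewrite dotC raddfN /= (dotC z). Qed.

Lemma dotBB x y z t :
  dot (x - y) (z - t) = dot x z - dot x t - dot y z + dot y t.
Proof. by rewrite dotDD !dotNl !raddfN /= opprK. Qed.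

Lemma dotMnl x z n : dot (x *+ n) z = dot x z *+ n.
Proof. by rewrite dotC raddfMn /= (dotC z). Qed.

Lemma dotMnr x z n : dot x (z *+ n) = dot x z *+ n.
Proof. exact: raddfMn. Qed.

Lemma K_coord : (K 0 ord0 = -3) * (forall i, K 0 (lift ord0 i) = 1).
Proof.
split=> [|i]; rewrite /K !mxE summxE.
  by rewrite big1 // => i _; rewrite !mxE.
rewrite (bigD1 i) //= big1 => [|j ji]; rewrite !mxE !eqxx //=.
by rewrite (inj_eq lift_inj) eq_sym (negbTE ji).
Qed.

Lemma dotK x : dot x K = - (3 * x 0 ord0 + \sum_(i < 8) x 0 (lift ord0 i)).
Proof.
rewrite /dot K_coord.1 (eq_bigr (fun i => x 0 (lift ord0 i))) => [|i _].
  by ring.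
by rewrite K_coord.2 mulr1.
Qed.

Lemma dot_KK : dot K K = 1.
Proof.
rewrite dotK K_coord.1 (eq_bigr (fun=> 1)) => [|i _]; last exact: K_coord.2.
by rewrite sumr_const card_ord.
Qed.

(** Orthogonality to [K] reads sum x_i = - 3 x_0; it turns the indefinite form
    into minus a sum of squares, and so gives negative definiteness of [K^perp]. *)
Lemma dot_sum_of_squares x : dot x K = 0 ->
  - 9 * dot x x = x 0 ord0 ^+ 2
    + \sum_(i < 8) (3 * x 0 (lift ord0 i) + x 0 ord0) ^+ 2.
Proof.
rewrite dotK /dot => /eqP; rewrite oppr_eq0 addrC addr_eq0 => /eqP sx.
under [in RHS]eq_bigr => i _.
  rewrite (_ : _ ^+ 2 = 9 * (x 0 (lift ord0 i) * x 0 (lift ord0 i))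
    + (6 * x 0 ord0 * x 0 (lift ord0 i) + x 0 ord0 ^+ 2)); last by ring.
  over.
rewrite !big_split /= -!mulr_sumr sx sumr_const card_ord; ring.
Qed.

Lemma dot_le0 x : dot x K = 0 -> dot x x <= 0.
Proof.
move=> /dot_sum_of_squares.
have : 0 <= \sum_(i < 8) (3 * x 0 (lift ord0 i) + x 0 ord0) ^+ 2.
  by apply: sumr_ge0 => i _; apply: sqr_ge0.
by have := sqr_ge0 (x 0 ord0); lia.
Qed.

Lemma dot_eq0 x : dot x K = 0 -> dot x x = 0 -> x = 0.
Proof.
move=> /dot_sum_of_squares + x2; rewrite x2 mulr0 => /esym/eqP.
rewrite paddr_eq0 ?sqr_ge0 ?sumr_ge0 //; last by move=> i _; rewrite sqr_ge0.
rewrite sqrf_eq0 psumr_eq0; last by move=> i _; rewrite sqr_ge0.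
case/andP=> /eqP x0 /allP xi; apply/rowP=> j; rewrite mxE.
case: (unliftP ord0 j) => [i|] -> //.
by have:= xi i (mem_index_enum i); rewrite x0 sqrf_eq0 addr0 mulf_eq0 => /eqP.
Qed.

Lemma dvd2_sqrD (a : int) : (2 %| a * a + a)%Z.
Proof.
rewrite -[X in _ + X]mulr1 -mulrDr dvdzE abszM Euclid_dvdM //.
by lia.
Qed.

(** [K] is a characteristic vector of the form, as adjunction predicts; in
    particular the form is even on [K^perp]. *)
Lemma dvd2_dotK x : (2 %| dot x x + dot x K)%Z.
Proof.
rewrite dotK /dot.
rewrite [X in (_ %| X)%Z](_ : _ = x 0 ord0 * x 0 ord0 - 3 * x 0 ord0
  - (\sum_(i < 8) (x 0 (lift ord0 i) * x 0 (lift ord0 i) + x 0 (lift ord0 i)))).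
  rewrite rpredB ?rpred_sum // => [|i _]; last exact: dvd2_sqrD.
  rewrite [X in X \in _](_ : _ = x 0 ord0 * x 0 ord0 + x 0 ord0
    - 2 * (2 * x 0 ord0)).
    by rewrite rpredB ?dvd2_sqrD ?dvdz_mulr.
  by ring.
by rewrite big_split /=; ring.
Qed.

Lemma L8P l : reflect (dot l l = -1 /\ dot l K = -1) (l \in L8).
Proof. by rewrite inE; apply: (iffP andP) => -[/eqP ? /eqP ?]. Qed.

(** The difference of two lines lies in [K^perp] and has square - 2 - 2 (l . m),
    so definiteness forces l . m >= -1, with equality only for l = m. *)
Lemma line_dot_ge0 l m : l \in L8 -> m \in L8 -> l != m -> 0 <= dot l m.
Proof.
move=> /L8P[l2 lK] /L8P[m2 mK] lm; rewrite leNgt; apply: contra lm => lm.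
have lmK : dot (l - m) K = 0 by rewrite dotDl dotNl lK mK subrr.
have lm2 : dot (l - m) (l - m) = - 2 - 2 * dot l m.
  by rewrite dotBB l2 m2 (dotC m l); ring.
rewrite -subr_eq0; apply/eqP/dot_eq0 => //.
by apply/eqP; rewrite eq_le dot_le0 //= lm2; lia.
Qed.

(** Pairing l_i with the common sum gives -1 on the left-hand side, whereas the
    right-hand side is nonnegative unless l_i is one of the m_j. *)
Lemma skew_sum_mem (I J : finType) (P : pred I) (Q : pred J)
    (l : I -> Pic) (m : J -> Pic) :
    (forall i, P i -> l i \in L8) ->
    (forall i j, P i -> P j -> i != j -> dot (l i) (l j) = 0) ->
    (forall j, Q j -> m j \in L8) ->
    \sum_(i | P i) l i = \sum_(j | Q j) m j ->
  forall i, P i -> exists2 j, Q j & l i = m j.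
Proof.
move=> lL l_skew mL lm i Pi.
have [/exists_inP[j Qj /eqP]|] := boolP [exists (j | Q j), l i == m j].
  by exists j.
rewrite negb_exists_in => /forall_inP lm_neq.
have : 0 <= dot (l i) (\sum_(j | Q j) m j).
  rewrite raddf_sum sumr_ge0 // => j Qj.
  by rewrite line_dot_ge0 ?lL ?mL ?lm_neq.
rewrite -lm raddf_sum (bigD1 i) //= big1 => [|j /andP[Pj ji]]; last first.
  by rewrite l_skew // eq_sym.
by have /L8P[-> _] := lL i Pi.
Qed.

Lemma skew_line_sum (T : finType) (A : {set T}) (m : T -> Pic) n :
    #|A| = n ->
    {in A, forall v, m v \in L8} ->
    {in A &, forall v w, v != w -> dot (m v) (m w) = 0} ->
  skew_line n (\sum_(v in A) m v).
Proof.
move=> <- mL m_skew; exists (fun i : 'I_#|A| => m (enum_val i)).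
  have m_dot (i j : 'I_#|A|) :
      i != j -> dot (m (enum_val i)) (m (enum_val j)) = 0.
    by move=> ij; rewrite m_skew ?enum_valP // (inj_eq enum_val_inj).
  split=> [i j mij|i|//]; last by rewrite mL ?enum_valP.
  apply/eqP/negPn/negP=> /m_dot; rewrite mij.
  by have /L8P[-> _] := mL _ (enum_valP j).
by rewrite -big_enum_val.
Qed.

(** * Binary codes *)

Definition supp n (v : 'rV['F_2]_n) : {set 'I_n} := [set i | v 0 i != 0].

Lemma F2E (a : 'F_2) : a = (a != 0)%:R.
Proof. by apply: val_inj; case: a => [] [|[|]]. Qed.

Lemma supp_inj n : injective (@supp n).
Proof.
move=> v w /setP vw; apply/rowP=> i; have:= vw i.
by rewrite !inE => vwi; rewrite (F2E (v 0 i)) vwi -F2E.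
Qed.

Lemma in_suppD n (v w : 'rV['F_2]_n) i :
  (i \in supp (v + w)) = (i \in supp v) (+) (i \in supp w).
Proof.
rewrite !inE mxE; move: (v 0 i) (w 0 i).
by do 2!case=> [[|[|//]] ?].
Qed.

Lemma supp0 n : supp (0 : 'rV_n) = set0.
Proof. by apply/setP=> i; rewrite !inE mxE. Qed.

Lemma card_supp n (v : 'rV['F_2]_n) : #|supp v| = (\sum_i (i \in supp v))%N.
Proof.
by rewrite -sum1_card big_mkcond /=; apply: eq_bigr => i _; case: ifP.
Qed.

Lemma card_suppD n (v w : 'rV['F_2]_n) :
  (#|supp (v + w)| + 2 * #|supp v :&: supp w| = #|supp v| + #|supp w|)%N.
Proof.
have -> : #|supp v :&: supp w| = (\sum_i ((i \in supp v) && (i \in supp w)))%N.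
  rewrite -sum1_card big_mkcond /=; apply: eq_bigr => i _.
  by rewrite in_setI; case: ifP.
rewrite !card_supp big_distrr -!big_split /=; apply: eq_bigr => i _.
by rewrite in_suppD; do 2!case: (i \in supp _).
Qed.

(** If some word contains [i], translation by it maps the words containing [i]
    injectively to the words avoiding [i]. *)
Lemma card_code_coord n (C : {set 'rV['F_2]_n}) (i : 'I_n) :
  {in C &, forall v w, v + w \in C} ->
  (2 * #|[set v in C | i \in supp v]| <= #|C|)%N.
Proof.
move=> addC; have [->|[w]] := set_0Vmem [set v in C | i \in supp v].
  by rewrite cards0.
rewrite inE => /andP[wC wi].
rewrite -(cardsID [set v | i \in supp v] C) mul2n -addnn -setIdE leq_add2l.
rewrite -(card_imset _ (addIr w)).
apply/subset_leq_card/subsetP=> _ /imsetP[v + ->].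
rewrite [v \in _]inE => /andP[vC vi].
by rewrite in_setD inE in_suppD vi wi addC.
Qed.

Lemma sum_card_supp n (C : {set 'rV['F_2]_n}) :
  (\sum_(v in C) #|supp v| = \sum_i #|[set v in C | i \in supp v]|)%N.
Proof.
under eq_bigr do rewrite card_supp; rewrite exchange_big /=.
apply: eq_bigr => i _; rewrite -sum1_card big_mkcond [RHS]big_mkcond /=.
by apply: eq_bigr => v _; rewrite !inE; case: (v \in C); case: (v 0 i != 0).
Qed.

(** If N is the number of words, there are 4 (N - 1) incidences between words and
    coordinates, and at most 7 N / 2 because no coordinate lies in more than half
    of the words.  So N <= 8, and N = 8 forces equality at every coordinate. *)
Lemma card_four_weight_code (C : {set 'rV['F_2]_7}) :
    {in C &, forall v w, v + w \in C} -> 0 \in C -> (8 <= #|C|)%N ->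
    {in C, forall v, v != 0 -> #|supp v| = 4%N} ->
  #|C| = 8%N /\ forall i, #|[set v in C | i \in supp v]| = 4%N.
Proof.
move=> addC C0 C8 C4.
pose deg i := #|[set v in C | i \in supp v]|.
have wt : (\sum_i deg i = 4 * #|C|.-1)%N.
  rewrite -sum_card_supp (bigD1 0) //= supp0 cards0 add0n.
  rewrite (eq_bigr (fun=> 4%N)) => [|v /andP[]]; last exact: C4.
  rewrite (cardsD1 0) C0 /= sum_nat_const mulnC; congr (4 * _)%N.
  by apply: eq_card => v; rewrite !inE andbC.
have deg_le i : (2 * deg i <= #|C|)%N by apply: card_code_coord.
have le_n : (2 * \sum_i deg i <= 7 * #|C|)%N.
  have := leq_sum (index_enum 'I_7) (fun i (_ : true) => deg_le i).
  by rewrite sum_nat_const card_ord -big_distrr.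
have n8 : #|C| = 8%N by lia.
split=> // i; have := deg_le i; rewrite -/(deg i) n8 => di.
have : (\sum_(j | j != i) deg j <= \sum_(j : 'I_7 | j != i) 4)%N.
  by apply: leq_sum => j _; have := deg_le j; lia.
rewrite sum_nat_const cardC1 card_ord.
by move: wt; rewrite (bigD1 i) //= n8; lia.
Qed.

(** * Sums of classes that are divisible by 2 *)

(** Modulo 2 the intersection form is the standard scalar product of F_2^9. *)
Lemma dot_mod2 x y :
  (dot x y)%:~R = \sum_j (x 0 j)%:~R * (y 0 j)%:~R :> 'F_2.
Proof.
rewrite big_ord_recl /dot rmorphB rmorphM rmorph_sum /=.
rewrite oppr_pchar2 ?pchar_Fp //; congr (_ + _).
by apply: eq_bigr => i _; rewrite rmorphM.
Qed.

Definition mod2mx n (a : 'I_n -> Pic) : 'M['F_2]_(n, 9) :=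
  \matrix_(i, j) (a i 0 j)%:~R.

(** The relations modulo 2 between the classes [a i]. *)
Definition code n (a : 'I_n -> Pic) : {set 'rV['F_2]_n} :=
  [set v | v *m mod2mx a == 0].

Definition supp_sum n (a : 'I_n -> Pic) (v : 'rV['F_2]_n) : Pic :=
  \sum_(i in supp v) a i.

Lemma code0 n (a : 'I_n -> Pic) : 0 \in code a.
Proof. by rewrite inE mul0mx. Qed.

Lemma codeD n (a : 'I_n -> Pic) :
  {in code a &, forall v w, v + w \in code a}.
Proof. by move=> v w; rewrite !inE mulmxDl => /eqP-> /eqP->; rewrite addr0. Qed.

(** The rows of the reduction A of [a] modulo 2 satisfy A A^T = 0, so the rank of
    A is at most half of 9, that is, at most 4. *)
Lemma card_code_isotropic n (a : 'I_n -> Pic) :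
  (forall i j, (2 %| dot (a i) (a j))%Z) -> (2 ^ (n - 4) <= #|code a|)%N.
Proof.
move=> even_a; have AAt : mod2mx a *m (mod2mx a)^T = 0.
  apply/matrixP=> i j; rewrite !mxE.
  transitivity ((dot (a i) (a j))%:~R : 'F_2).
    by rewrite dot_mod2; apply: eq_bigr => k _; rewrite !mxE.
  by apply/eqP; rewrite -(dvdz_pcharf (pchar_Fp (isT : prime 2))).
have rankA : (\rank (mod2mx a) <= 4)%N.
  by have := mulmx0_rank_max AAt; rewrite mxrank_tr; lia.
have -> : code a = mxabelem.rowg (kermx (mod2mx a)).
  by apply/setP=> v; rewrite mxabelem.mem_rowg inE; apply/eqP/sub_kermxP.
by rewrite mxabelem.card_rowg card_Fp // mxrank_ker leq_exp2l // leq_sub2l.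
Qed.

(** A total function, so that half-sums need no choice of a witness; it is
    meaningful on the classes divisible by 2. *)
Definition half (x : Pic) : Pic := map_mx (fun a : int => (a %/ 2)%Z) x.

Lemma halfK (x y : Pic) : x = y *+ 2 -> half x = y.
Proof.
move=> ->; apply/rowP=> j.
by rewrite mulr2n !mxE -mulr2n -(mulr_natr (y 0 j)) mulzK.
Qed.

Lemma codeP n (a : 'I_n -> Pic) (v : 'rV['F_2]_n) :
  reflect (exists x, supp_sum a v = x *+ 2) (v \in code a).
Proof.
have coordE j : (v *m mod2mx a) 0 j = (supp_sum a v 0 j)%:~R.
  rewrite mxE /supp_sum summxE rmorph_sum [RHS]big_mkcond /=.
  apply: eq_bigr => i _; rewrite mxE [v 0 i]F2E inE.
  by case: (v 0 i != 0); rewrite ?mul1r ?mul0r.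
have dvd2 j : ((v *m mod2mx a) 0 j == 0) = (2 %| supp_sum a v 0%R j)%Z.
  by rewrite coordE -(dvdz_pcharf (pchar_Fp (isT : prime 2))).
rewrite inE; apply: (iffP eqP) => [vA|[x vx]].
  exists (half (supp_sum a v)); apply/rowP=> j; rewrite mulr2n !mxE.
  have := dvd2 j; rewrite vA mxE eqxx => /esym/divzK {1}<-.
  by rewrite mulr_natr mulr2n.
apply/rowP=> j; apply/eqP; rewrite [X in _ == X]mxE dvd2 vx mulr2n mxE.
by rewrite -mulr2n -(mulr_natr (x 0 j)) dvdz_mull.
Qed.

Lemma half_supp_sum n (a : 'I_n -> Pic) (v : 'rV['F_2]_n) :
  v \in code a -> half (supp_sum a v) *+ 2 = supp_sum a v.
Proof. by case/codeP=> x vx; rewrite (halfK vx) vx. Qed.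

Lemma double_inj (x y : Pic) : x *+ 2 = y *+ 2 -> x = y.
Proof. by move=> xy; rewrite -(halfK (erefl (x *+ 2))) xy (halfK erefl). Qed.

(** * The code of seven orthogonal roots *)

Section SevenOrthogonalRoots.

Variable p : 'I_7 -> Pic.
Hypothesis p_line : forall i, p i \in L8.
Hypothesis p_dot : forall i j, i != j -> dot (p i) (p j) = 1.

Let a i : Pic := p i + K.
Let C := code a.

Lemma root_dotK i : dot (a i) K = 0.
Proof. by have /L8P[_ pK] := p_line i; rewrite /a dotDl pK dot_KK. Qed.

Lemma root_dot i j : dot (a i) (a j) = if i == j then -2 else 0.
Proof.
have /L8P[p2 pK] := p_line i; have /L8P[_ qK] := p_line j.
rewrite dotDD (dotC K (p j)) pK qK dot_KK.
by case: eqP => [<-|/eqP/p_dot->] //; rewrite p2.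
Qed.

Lemma supp_sum_dotK v : dot (supp_sum a v) K = 0.
Proof. by rewrite dot_suml big1 // => i _; rewrite root_dotK. Qed.

Lemma supp_sum_dot_root v i :
  dot (supp_sum a v) (a i) = if i \in supp v then -2 else 0.
Proof.
rewrite dot_suml; under eq_bigr do rewrite root_dot.
case: ifP => vi.
  by rewrite (bigD1 i) //= eqxx big1 ?addr0 // => j /andP[_ /negbTE->].
by rewrite big1 // => j vj; case: eqP => // ji; rewrite -ji vj in vi.
Qed.

Lemma supp_sum_dot v w :
  dot (supp_sum a v) (supp_sum a w) = - 2 * #|supp v :&: supp w|%:Z.
Proof.
rewrite [X in dot _ X]/supp_sum raddf_sum /=.
under eq_bigr do rewrite supp_sum_dot_root.
rewrite -big_mkcondr /= sumr_const -(mulr_natr (-2)).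
rewrite -[#|_ :&: _|%:Z]natz; congr (_ * _%:R).
by apply: eq_card => i; rewrite in_setI andbC.
Qed.

Let b v := half (supp_sum a v).

Lemma half_dotK v : v \in C -> dot (b v) K = 0.
Proof.
move=> /half_supp_sum bv; have := supp_sum_dotK v.
by rewrite -bv dotMnl mulr2n -/(b v); lia.
Qed.

Lemma half_dot_root v i :
  v \in C -> dot (b v) (a i) = if i \in supp v then -1 else 0.
Proof.
move=> /half_supp_sum bv; have := supp_sum_dot_root v i.
by rewrite -bv dotMnl mulr2n -/(b v); case: ifP; lia.
Qed.

Lemma half_dot v w : v \in C -> w \in C ->
  2 * dot (b v) (b w) = - #|supp v :&: supp w|%:Z.
Proof.
move=> /half_supp_sum bv /half_supp_sum bw; have := supp_sum_dot v w.
by rewrite -bv -bw dotMnl dotMnr !mulr2n -/(b v) -/(b w); lia.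
Qed.

(** The square of the half-sum is minus half of the weight and it is even, so the
    weight is a multiple of 4 between 1 and 7. *)
Lemma code_weight : {in C, forall v, v != 0 -> #|supp v| = 4%N}.
Proof.
move=> v vC v0.
have := dvd2_dotK (b v); rewrite half_dotK // addr0.
have := half_dot vC vC; rewrite setIid.
have : (#|supp v| <= 7)%N by rewrite -[X in (_ <= X)%N](card_ord 7) max_card.
have : #|supp v| != 0%N.
  rewrite cards_eq0; apply: contra v0 => /eqP sv.
  by apply/eqP/supp_inj; rewrite sv supp0.
by lia.
Qed.

Lemma card_code :
  #|C| = 8%N /\ forall i, #|[set v in C | i \in supp v]| = 4%N.
Proof.
apply: card_four_weight_code code_weight; [exact: codeD|exact: code0|].
apply: (@card_code_isotropic 7) => i j; rewrite root_dot.
by case: ifP.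
Qed.

Lemma card_code_nz : #|C :\ 0| = 7%N.
Proof. by have [+ _] := card_code; rewrite (cardsD1 0) code0 => -[]. Qed.

(** The sum of the two words is a nonzero word, so 4 = 4 + 4 - 2 #|overlap|. *)
Lemma code_supp_cap v w : v \in C -> w \in C -> v != 0 -> w != 0 -> v != w ->
  #|supp v :&: supp w| = 2%N.
Proof.
move=> vC wC v0 w0 vw; have := card_suppD v w.
rewrite !code_weight ?codeD //; first by lia.
apply: contra vw => /eqP vw0; apply/eqP/supp_inj/setP=> i.
by have := in_suppD v w i; rewrite vw0 supp0 in_set0; do 2!case: (i \in supp _).
Qed.

(** The line whose root is the half-sum of the word [v]. *)
Definition corner_line v := b v - K.

Lemma corner_line_L8 v : v \in C -> v != 0 -> corner_line v \in L8.
Proof.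
move=> vC v0; have := half_dot vC vC; rewrite setIid code_weight // => v2.
apply/L8P; split.
  by rewrite dotBB (dotC K) half_dotK // dot_KK; lia.
by rewrite dotDl dotNl half_dotK // dot_KK.
Qed.

Lemma corner_line_dot v w : v \in C -> w \in C -> v != 0 -> w != 0 ->
  v != w -> dot (corner_line v) (corner_line w) = 0.
Proof.
move=> vC wC v0 w0 vw; have := half_dot vC wC; rewrite code_supp_cap // => b2.
by rewrite dotBB (dotC K) !half_dotK // dot_KK; lia.
Qed.

Lemma corner_line_vertex v i : v \in C ->
  dot (p i) (corner_line v) = if i \in supp v then 0 else 1.
Proof.
move=> vC; have := half_dot_root i vC.
have /L8P[_ pK] := p_line i.
rewrite (dotC (p i)) dotDl dotNl raddfD /= half_dotK // addr0 (dotC K) pK => ->.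
by case: ifP.
Qed.

(** Twice the sum of the half-sums counts each root 4 times, once for each word
    through its coordinate; the seven terms - K cancel half of the 14 K that
    come from twice the sum of the roots. *)
Lemma sum_corner_line :
  \sum_(v in C :\ 0) corner_line v = (\sum_i p i) *+ 2 + K *+ 7.
Proof.
have [_ C4] := card_code.
have sum_b : \sum_(v in C :\ 0) b v = (\sum_i a i) *+ 2.
  apply: double_inj; rewrite -mulrnA -!sumrMnl.
  transitivity (\sum_(v in C) supp_sum a v).
    rewrite [RHS](bigD1 0) ?code0 //= /supp_sum supp0 big_set0 add0r.
    apply: eq_big => v; first by rewrite !inE andbC.
    by rewrite !inE => /andP[_ vC]; rewrite half_supp_sum // inE.
  rewrite /supp_sum; under eq_bigr do rewrite big_mkcond.
  rewrite exchange_big; apply: eq_bigr => i _.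
  rewrite -big_mkcondr /= sumr_const; congr (_ *+ _); apply: etrans (C4 i).
  by apply: eq_card => v; rewrite [in RHS]in_set.
rewrite sumrB sum_b sumr_const card_code_nz big_split /= sumr_const card_ord.
by rewrite mulrnDl (mulr2n (K *+ 7)) addrA addrK.
Qed.

(** With four roots of square -2, each of product -1 with c = l + K, the class
    2 c - (their sum) has square 4 (-2) - 4 (-4) + 4 (-2) = 0. *)
Lemma cornered_code (S : {set 'I_7}) l : l \in L8 -> #|S| = 4%N ->
  {in S, forall i, dot (p i) l = 0} -> exists2 v, v \in C & supp v = S.
Proof.
move=> /L8P[l2 lK] S4 Sl; pose v : 'rV['F_2]_7 := \row_i (i \in S)%:R.
have vS : supp v = S by apply/setP=> i; rewrite inE mxE; case: (i \in S).
exists v => //; apply/codeP; exists (l + K).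
apply/eqP; rewrite -subr_eq0; apply/eqP.
have cK : dot (l + K) K = 0 by rewrite dotDl lK dot_KK.
have c2 : dot (l + K) (l + K) = -2.
  by rewrite raddfD /= cK addr0 dotDl l2 dotC lK.
have cv : dot (supp_sum a v) (l + K) = -4.
  rewrite dot_suml vS (eq_bigr (fun=> -1)) => [|i iS].
    by rewrite sumr_const S4.
  by rewrite raddfD /= root_dotK addr0 dotDl Sl // dotC lK.
apply: dot_eq0.
  by rewrite dotDl dotNl dotMnl supp_sum_dotK cK; lia.
rewrite dotBB !dotMnr !dotMnl cv (dotC _ (supp_sum a v)) cv.
by rewrite supp_sum_dot setIid vS S4 c2.
Qed.

End SevenOrthogonalRoots.

(** * Polytopes as indexed families *)

Lemma polytope_enum n (P : {fset Pic}) : A81_polytope n P ->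
  exists p : 'I_n.+1 -> Pic,
    [/\ injective p, P = [fset p i | i in 'I_n.+1], center P = \sum_i p i,
        forall i, p i \in L8
      & forall i j, i != j -> dot (p i) (p j) = 1].
Proof.
case=> Pn PL Pdot; pose p (i : 'I_n.+1) := nth 0 (P : seq Pic) i.
have pP i : p i \in P by rewrite mem_nth // Pn.
have p_inj : injective p.
  by move=> i j /eqP; rewrite nth_uniq ?Pn ?fset_uniq // => /eqP/val_inj.
exists p; split=> // [||i|i j ij].
- apply/fsetP=> x; apply/idP/imfsetP => [/(nthP 0)[k kn <-]|[i _ ->]] //.
  by rewrite Pn in kn; exists (Ordinal kn).
- by rewrite /center (big_nth 0) big_mkord Pn.
- exact: PL.
- by rewrite Pdot // (inj_eq p_inj).
Qed.

Lemma card_fset_image (T : finType) (p : T -> Pic) (S : {set T}) :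
  injective p -> #|` [fset p i | i in S]| = #|S|.
Proof. by move=> p_inj; rewrite card_imfset //= -cardE. Qed.

(** * Cornered subpolytopes *)

Theorem theorem26 (D : Pic)
    (hD : exists2 P : {fset Pic}, A81_polytope 6 P & D = center P) :
  skew_line 7 (D *+ 2 + K *+ 7) /\
  (forall l : 'I_7 -> Pic,
     skew_family l -> D *+ 2 + K *+ 7 = \sum_(i < 7) l i ->
     forall P : {fset Pic}, A81_polytope 6 P -> center P = D ->
     exists Q : 'I_7 -> {fset Pic},
       [/\ injective Q,
           forall R : {fset Pic},
             [/\ R `<=` P, A81_polytope 3 R & cornered R] <->
             (exists i : 'I_7, R = Q i)
         & forall i : 'I_7, {subset Q i <= vertex_figure (l i)}]).
Proof.
split.
  have [P P6 ->] := hD.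
  have [p [p_inj _ -> p_line p_dot]] := polytope_enum P6.
  rewrite -(sum_corner_line p_line p_dot).
  apply: skew_line_sum => [|v|v w]; first exact: card_code_nz.
    by rewrite in_setD1 => /andP[v0 vC]; apply: corner_line_L8.
  by rewrite !in_setD1 => /andP[v0 vC] /andP[w0 wC]; apply: corner_line_dot.
move=> l [l_inj l_line l_skew] lD P P6 PD.
have [p [p_inj PE pD p_line p_dot]] := polytope_enum P6.
set C := code (fun i => p i + K); pose m := corner_line p.
have lm : \sum_(i < 7) l i = \sum_(v in C :\ 0) m v.
  by rewrite -lD -PD pD -(sum_corner_line p_line p_dot).
have m_line v : v \in C :\ 0 -> m v \in L8.
  by rewrite in_setD1 => /andP[v0 vC]; apply: corner_line_L8.
have m_skew v w : v \in C :\ 0 -> w \in C :\ 0 -> v != w -> dot (m v) (m w) = 0.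
  rewrite !in_setD1 => /andP[v0 vC] /andP[w0 wC].
  exact: corner_line_dot.
have l_m i : exists2 v, v \in C :\ 0 & l i = m v.
  apply: (skew_sum_mem _ _ m_line lm) => // i1 i2 _ _; exact: l_skew.
have m_l v : v \in C :\ 0 -> exists i, l i = m v.
  move=> vC; have l_line' i : true -> l i \in L8 by [].
  have [i _ ->] := skew_sum_mem m_line m_skew l_line' (esym lm) vC.
  by exists i.
pose Q i := [fset x in P | dot x (l i) == 0].
have QE i v : v \in C -> l i = m v -> Q i = [fset p k | k in supp v].
  move=> vC liv; apply/fsetP=> x; rewrite !inE /= PE.
  apply/andP/imfsetP => /= [[/imfsetP[k _ ->]]|[k kv ->]].
    rewrite liv (corner_line_vertex p_line) //.
    by case: ifP => // kv _; exists k.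
  split; first by apply/imfsetP; exists k.
  by rewrite liv (corner_line_vertex p_line) // kv.
have Q_vertex i : {subset Q i <= vertex_figure (l i)}.
  case: P6 => _ PL _ x; rewrite !inE => /andP[xP xl].
  by have := PL x xP; rewrite !inE xl => ->.
exists Q; split=> // [i j Qij|R].
  have [v + lv] := l_m i; have [w + lw] := l_m j.
  rewrite !in_setD1 => /andP[w0 wC] /andP[v0 vC].
  apply: l_inj; rewrite lv lw; congr m; apply: supp_inj.
  move: Qij; rewrite (QE i v) // (QE j w) // => /fsetP pvw.
  apply/setP=> k; have := pvw (p k).
  by rewrite !mem_imfset.
split=> [[RP [R4 _ _] [c cL Rc]]|[i ->]].
  pose S := [set k | p k \in R].
  have RS : R = [fset p k | k in S].
    apply/fsetP=> x; apply/idP/imfsetP => /= [xR|[k kS ->]].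
      2: by rewrite inE in kS.
    have /imfsetP[k _ xk] : x \in [fset p i | i in 'I_7].
      by rewrite -PE (fsubsetP RP).
    by exists k; rewrite // inE -xk.
  have S4 : #|S| = 4%N by rewrite -(card_fset_image S p_inj) -RS.
  have [k kS|v vC vS] := cornered_code p_line p_dot cL S4.
    by have := Rc (p k); rewrite !inE in kS * => /(_ kS)/andP[_ /eqP].
  have [|i lv] := m_l v.
    rewrite in_setD1 vC andbT; apply: contraTneq isT => v0.
    by move: S4; rewrite -vS v0 supp0 cards0.
  by exists i; rewrite (QE i v) // vS.
have [v + lv] := l_m i; rewrite in_setD1 => /andP[v0 vC].
split.
- by apply/fsubsetP=> x; rewrite inE => /andP[].
- have QP x : x \in Q i -> x \in P by rewrite inE => /andP[].
  case: P6 => _ PL Pdot.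
  split=> [|x /QP/PL //|x y /QP xP /QP yP]; last exact: Pdot.
  by rewrite (QE i v) // card_fset_image // (code_weight p_line).
- by exists (l i).
Qed.
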